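(* Let $\mathbf{C}$ be a category and let $\Sigma$ and $\Xi$ be two $2$-polygraphs that are presentations of $\mathbf{C}$, with canonical projections $\pi_\Sigma:\Sigma^{\top}\to\mathbf{C}$ and $\pi_\Xi:\Xi^{\top}\to\mathbf{C}$. Let $F:\Sigma^{\top}\to\Xi^{\top}$ and $G:\Xi^{\top}\to\Sigma^{\top}$ be $2$-functors such that $\pi_\Xi F=\pi_\Sigma$ and $\pi_\Sigma G=\pi_\Xi$, and let $\sigma_u:GF(u)\Rightarrow u$ (in $\Sigma^{\top}$, for every $1$-cell $u$ of $\Sigma^{\top}$) and $\tau_v:FG(v)\Rightarrow v$ (in $\Xi^{\top}$, for every $1$-cell $v$ of $\Xi^{\top}$) be families of $2$-cells that are functorial, i.e. $\sigma_{1_x}=1_{1_x}$, $\tau_{1_y}=1_{1_y}$, $\sigma_{uu'}=\sigma_u\star_0\sigma_{u'}$ and $\tau_{vv'}=\tau_v\star_0\tau_{v'}$ for all $0$-cells $x,y$ and all composable $1$-cells $u,u'$ of $\Sigma^{\top}$ and $v,v'$ of $\Xi^{\top}$. If $\Gamma$ is a homotopy basis of $\Sigma^{\top}$, then $$\Delta \;=\; F(\Gamma)\,\amalg\,\tau_{\Xi}$$ is a homotopy basis of $\Xi^{\top}$, where: (1) the cellular extension $F(\Gamma)$ of $\Xi^{\top}$ contains one $3$-cell $F(\gamma):F(f)\Rrightarrow F(g)$ for every $3$-cell $\gamma:f\Rrightarrow g$ of $\Gamma$; (2) the cellular extension $\tau_{\Xi}$ of $\Xi^{\top}$ contains one $3$-cell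 $\tau_\alpha: FG(\alpha)\star_1\tau_v \Rrightarrow \tau_u\star_1\alpha$ for every $2$-cell $\alpha:u\Rightarrow v$ of $\Xi$.
   Context: Composition is written in diagrammatic order: $u\star_0 v$ (or $uv$) is the composite of $u:x\to y$ and $v:y\to z$; in a $2$-category $\star_0$ denotes composition along $0$-cells and $\star_1$ composition of $2$-cells along $1$-cells. A $2$-polygraph $\Sigma=(\Sigma_0,\Sigma_1,\Sigma_2)$ consists of a graph $(\Sigma_0,\Sigma_1)$ and a set $\Sigma_2$ equipped with a map from $\Sigma_2$ to the set of pairs $(u,v)$ of parallel $1$-cells of the free category $\Sigma_1^*$ on that graph; an element $\alpha$ sent to $(u,v)$ is written $\alpha:u\Rightarrow v$. The category presented by $\Sigma$ is the quotient $\overline{\Sigma}$ of $\Sigma_1^*$ by the smallest congruence identifying $u$ and $v$ for each $\alpha:u\Rightarrow v$ in $\Sigma_2$. A presentation of a category $\mathbf{C}$ is a $2$-polygraph $\Sigma$ with an isomorphism $\overline{\Sigma}\cong\mathbf{C}$. $\Sigma^{\top}$ is the free $(2,1)$-category over $\Sigma$: the $2$-category whose underlying category is $\Sigma_1^*$ and whose $2$-cells are freely generated, under $\star_0$, $\star_1$, identities and inverses for $\star_1$, by the elements of $\Sigma_2$ (so every $2$-cell is $\star_1$-invertible). The canonical projection $\pi_\Sigma:\Sigma^{\top}\to\mathbf{C}$ is the quotient map $\Sigma_1^*\to\overline{\Sigma}\cong\mathbf{C}$ on $1$-cells and sends $2$-cells to identities. A cellular extension of a $2$-category $\mathcal{C}$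 is a set $\Gamma$ equipped with a map from $\Gamma$ to the set of pairs $(f,g)$ of parallel $2$-cells of $\mathcal{C}$ (same source and same target); an element $\gamma$ sent to $(f,g)$ is called a $3$-cell and written $\gamma:f\Rrightarrow g$. A congruence on $\mathcal{C}$ is an equivalence relation on parallel $2$-cells compatible with $\star_0$ and $\star_1$; $\equiv_\Gamma$ is the smallest congruence with $f\equiv_\Gamma g$ for every $\gamma:f\Rrightarrow g$ in $\Gamma$. $\Gamma$ is a homotopy basis of $\mathcal{C}$ if $f\equiv_\Gamma g$ for all parallel $2$-cells $f,g$ of $\mathcal{C}$. *)

(* Defs.v *)
From mathcomp Require Import all_boot generic_quotient.
From mathcomp Require Import boolp.
From Stdlib Require Import RelationClasses.

Set Implicit Arguments.
Unset Strict Implicit.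
Unset Printing Implicit Defensive.

(******************************************************************************)
(* Categories and 2-categories are presented globularly: cells of each        *)
(* dimension form one type, with source and target maps, and a composite is   *)
(* formed from a proof that boundaries match.  In this way, cells that are    *)
(* parallel only up to a propositional equality (such as F (G v) and v) need  *)
(* no transport.  Laws quantify over all composability proofs; such proofs    *)
(* always exist, by the boundary laws, and are unique by proof irrelevance.   *)
(* Composites of cells are written in diagrammatic order.                     *)
(******************************************************************************)

Record category := Category {
  ob : Type;
  mor : Type;
  src : mor -> ob;
  tgt : mor -> ob;
  idm : ob -> mor;
  cmp : forall u v : mor, tgt u = src v -> mor;
  src_id : forall x, src (idm x) = x;
  tgt_id : forall x, tgt (idm x) = x;
  src_cmp : forall u v h, src (@cmp u v h) = src u;
  tgt_cmp : forall u v h, tgt (@cmp u v h) = tgt v;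
  cmp_idl : forall u h, @cmp (idm (src u)) u h = u;
  cmp_idr : forall u h, @cmp u (idm (tgt u)) h = u;
  cmpA : forall u v w huv huv_w hvw hu_vw,
    @cmp (@cmp u v huv) w huv_w = @cmp u (@cmp v w hvw) hu_vw
}.
Arguments idm {c} x.
Arguments cmp {c} u v h.

Record functor (C D : category) := Functor {
  fob : ob C -> ob D;
  fmor : mor C -> mor D;
  fsrc : forall u, src (fmor u) = fob (src u);
  ftgt : forall u, tgt (fmor u) = fob (tgt u);
  fid : forall x, fmor (idm x) = idm (fob x);
  fcmp : forall u v h h', fmor (cmp u v h) = cmp (fmor u) (fmor v) h'
}.

Definition functor_id (C : category) : functor C C.
Proof.
exists (fun x => x) (fun u => u) => // u v h h'.
by rewrite (Prop_irrelevance h h').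
Defined.

(* [functor_comp F G] is "F after G". *)
Definition functor_comp (C D E : category) (F : functor D E) (G : functor C D) :
  functor C E.
Proof.
exists (fun x => fob F (fob G x)) (fun u => fmor F (fmor G u)).
- by move=> u; rewrite !fsrc.
- by move=> u; rewrite !ftgt.
- by move=> x; rewrite !fid.
- move=> u v h h'.
  have h1 : tgt (fmor G u) = src (fmor G v) by rewrite ftgt fsrc h.
  by rewrite (fcmp _ h1) (fcmp _ h').
Defined.

Record cat_iso (C D : category) := CatIso {
  iso_fun : functor C D;
  iso_inv : functor D C;
  iso_funK : functor_comp iso_inv iso_fun = functor_id C;
  iso_invK : functor_comp iso_fun iso_inv = functor_id D
}.

Record two_category := TwoCategory {
  under :> category;
  cell : Type;
  csrc : cell -> mor under;
  ctgt : cell -> mor under;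
  csrc_src : forall f, src (csrc f) = src (ctgt f);
  csrc_tgt : forall f, tgt (csrc f) = tgt (ctgt f);
  id2 : mor under -> cell;
  (* composition along 1-cells *)
  vcmp : forall f g : cell, ctgt f = csrc g -> cell;
  (* composition along 0-cells *)
  hcmp : forall f g : cell, tgt (csrc f) = src (csrc g) -> cell;
  csrc_id : forall u, csrc (id2 u) = u;
  ctgt_id : forall u, ctgt (id2 u) = u;
  csrc_v : forall f g h, csrc (@vcmp f g h) = csrc f;
  ctgt_v : forall f g h, ctgt (@vcmp f g h) = ctgt g;
  csrc_h : forall f g h h', csrc (@hcmp f g h) = cmp (csrc f) (csrc g) h';
  ctgt_h : forall f g h h', ctgt (@hcmp f g h) = cmp (ctgt f) (ctgt g) h';
  vcmp_idl : forall f h, @vcmp (id2 (csrc f)) f h = f;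
  vcmp_idr : forall f h, @vcmp f (id2 (ctgt f)) h = f;
  vcmpA : forall f g k hfg hfg_k hgk hf_gk,
    @vcmp (@vcmp f g hfg) k hfg_k = @vcmp f (@vcmp g k hgk) hf_gk;
  hcmp_idl : forall f h, @hcmp (id2 (idm (src (csrc f)))) f h = f;
  hcmp_idr : forall f h, @hcmp f (id2 (idm (tgt (csrc f)))) h = f;
  hcmpA : forall f g k hfg hfg_k hgk hf_gk,
    @hcmp (@hcmp f g hfg) k hfg_k = @hcmp f (@hcmp g k hgk) hf_gk;
  hcmp_id2 : forall u v h h', @hcmp (id2 u) (id2 v) h = id2 (cmp u v h');
  exchange : forall f g f' g' hfg hfg' h hff' hgg' h',
    @hcmp (@vcmp f g hfg) (@vcmp f' g' hfg') h =
    @vcmp (@hcmp f f' hff') (@hcmp g g' hgg') h'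
}.
Arguments id2 {t} u.
Arguments vcmp {t} f g h.
Arguments hcmp {t} f g h.

Definition parallel (A : two_category) (f g : cell A) : Prop :=
  csrc f = csrc g /\ ctgt f = ctgt g.

Definition invertible (A : two_category) (f : cell A) : Prop :=
  exists (g : cell A) (h : ctgt f = csrc g) (h' : ctgt g = csrc f),
    vcmp f g h = id2 (csrc f) /\ vcmp g f h' = id2 (ctgt f).

Record two_functor (A B : two_category) := TwoFunctor {
  ufun :> functor A B;
  fcell : cell A -> cell B;
  fcsrc : forall f, csrc (fcell f) = fmor ufun (csrc f);
  fctgt : forall f, ctgt (fcell f) = fmor ufun (ctgt f);
  fid2 : forall u, fcell (id2 u) = id2 (fmor ufun u);
  fvcmp : forall f g h h', fcell (vcmp f g h) = vcmp (fcell f) (fcell g) h';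
  fhcmp : forall f g h h', fcell (hcmp f g h) = hcmp (fcell f) (fcell g) h'
}.

(* [two_functor_comp F G] is "F after G". *)
Definition two_functor_comp (A B C : two_category)
  (F : two_functor B C) (G : two_functor A B) : two_functor A C.
Proof.
exists (functor_comp F G) (fun f => fcell F (fcell G f)).
- by move=> f; rewrite !fcsrc.
- by move=> f; rewrite !fctgt.
- by move=> u; rewrite !fid2.
- move=> f g h h'.
  have h1 : ctgt (fcell G f) = csrc (fcell G g) by rewrite fctgt fcsrc h.
  by rewrite (fvcmp _ h1) (fvcmp _ h').
- move=> f g h h'.
  have h1 : tgt (csrc (fcell G f)) = src (csrc (fcell G g)).
    by rewrite !fcsrc ftgt fsrc h.
  by rewrite (fhcmp _ h1) (fhcmp _ h').
Defined.

(* A category seen as a 2-category with only identity 2-cells: the 2-cell     *)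
(* [u : mor C] is the identity of the 1-cell u.                               *)
Definition locally_discrete (C : category) : two_category.
Proof.
refine (@TwoCategory C (mor C) (fun u => u) (fun u => u) _ _ (fun u => u)
  (fun f _ _ => f) (@cmp C) _ _ _ _ _ _ _ _ _ _ _ _ _ _) => //.
- by move=> f g h h'; rewrite (Prop_irrelevance h h').
- by move=> f g h h'; rewrite (Prop_irrelevance h h').
- exact: cmp_idl.
- exact: cmp_idr.
- exact: cmpA.
- by move=> f g h h'; rewrite (Prop_irrelevance h h').
- by move=> f g f' g' _ _ h h' _ _; rewrite (Prop_irrelevance h h').
Defined.

Section Quotient.
Variables (T : Type) (R : T -> T -> Prop) (eqR : Equivalence R).

Let r (x y : {classic T}) : bool := `[< R x y >].

Let r_refl : reflexive r.
Proof. by move=> x; apply/asboolP; apply: Equivalence_Reflexive. Qed.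

Let r_sym : symmetric r.
Proof.
by move=> x y; apply/asboolP/asboolP; apply: (@Equivalence_Symmetric _ _ eqR).
Qed.

Let r_trans : transitive r.
Proof.
move=> y x z /asboolP xy /asboolP yz; apply/asboolP.
exact: (@Equivalence_Transitive _ _ eqR) xy yz.
Qed.

Definition quot_rel : equiv_rel {classic T} := EquivRel r r_refl r_sym r_trans.

Definition quot : Type := {eq_quot quot_rel}%qT.

Definition cls (x : T) : quot := (\pi_({eq_quot quot_rel}) (x : {classic T}))%qT.

Definition rep (q : quot) : T := repr (q : {eq_quot quot_rel}%qT).

Lemma repK q : cls (rep q) = q.
Proof. exact: reprK. Qed.

Lemma clsP x y : cls x = cls y <-> R x y.
Proof.
split=> [/(@eqmodP {classic T} quot_rel)/asboolP // | xy].
by apply/(@eqmodP {classic T} quot_rel)/asboolP.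
Qed.

Lemma rep_cls x : R (rep (cls x)) x.
Proof. by apply/clsP; rewrite repK. Qed.

End Quotient.
Arguments cls {T R} eqR x.
Arguments rep {T R eqR} q.

Record congruence1 (C : category) (R : mor C -> mor C -> Prop) : Prop := {
  congr1_par : forall u v, R u v -> src u = src v /\ tgt u = tgt v;
  congr1_equiv : Equivalence R;
  congr1_cmp : forall u u' v v' h h',
    R u u' -> R v v' -> R (cmp u v h) (cmp u' v' h')
}.

Section QuotientCategory.
Variables (C : category) (R : mor C -> mor C -> Prop) (cR : congruence1 R).
Let eR := congr1_equiv cR.

Let rsrc u : src (rep (cls eR u)) = src u.
Proof. by case: (congr1_par cR (rep_cls eR u)). Qed.

Let rtgt u : tgt (rep (cls eR u)) = tgt u.
Proof. by case: (congr1_par cR (rep_cls eR u)). Qed.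

Let rcmp u v h h' : cls eR (cmp (rep (cls eR u)) (rep (cls eR v)) h)
                  = cls eR (cmp u v h').
Proof.
by apply/clsP; apply: (congr1_cmp cR); apply: rep_cls.
Qed.

Definition quot_cat : category.
Proof.
refine (@Category (ob C) (quot eR) (fun q => src (rep q)) (fun q => tgt (rep q))
  (fun x => cls eR (idm x)) (fun p q h => cls eR (cmp (rep p) (rep q) h))
  _ _ _ _ _ _ _).
- by move=> x; rewrite rsrc src_id.
- by move=> x; rewrite rtgt tgt_id.
- by move=> u v h; rewrite rsrc src_cmp.
- by move=> u v h; rewrite rtgt tgt_cmp.
- move=> p h; rewrite -[RHS]repK; apply/clsP.
  have h' : tgt (idm (src (rep p))) = src (rep p) by rewrite tgt_id.
  rewrite -[X in R _ X](cmp_idl h').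
  by apply: (congr1_cmp cR); [apply: rep_cls|apply: Equivalence_Reflexive].
- move=> p h; rewrite -[RHS]repK; apply/clsP.
  have h' : tgt (rep p) = src (idm (tgt (rep p))) by rewrite src_id.
  rewrite -[X in R _ X](cmp_idr h').
  by apply: (congr1_cmp cR); [apply: Equivalence_Reflexive|apply: rep_cls].
- move=> p q s h1 h2 h3 h4; apply/clsP.
  have h2' : tgt (cmp (rep p) (rep q) h1) = src (rep s) by rewrite tgt_cmp.
  have h4' : tgt (rep p) = src (cmp (rep q) (rep s) h3) by rewrite src_cmp.
  apply: (@Equivalence_Transitive _ _ eR _ (cmp _ _ h2')).
    by apply: (congr1_cmp cR); [apply: rep_cls|apply: Equivalence_Reflexive].
  rewrite (cmpA h2' h4'); apply: (congr1_cmp cR).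
    exact: Equivalence_Reflexive.
  by apply: (@Equivalence_Symmetric _ _ eR); apply: rep_cls.
Defined.

Definition quot_functor : functor C quot_cat.
Proof.
refine (@Functor C quot_cat (fun x => x) (cls eR) _ _ _ _) => //.
by move=> u v h h'; rewrite /= rcmp.
Defined.

End QuotientCategory.

Definition least_congruence1 (C : category) (P : mor C -> mor C -> Prop)
  (u v : mor C) : Prop :=
  forall R, congruence1 R -> (forall u v, P u v -> R u v) -> R u v.

Lemma least_congruence1P (C : category) (P : mor C -> mor C -> Prop) :
  (forall u v, P u v -> src u = src v /\ tgt u = tgt v) ->
  congruence1 (least_congruence1 P).
Proof.
move=> parP; split.
- move=> u v /(_ (fun u v => src u = src v /\ tgt u = tgt v)); apply=> //.
  split=> //; first by split=> [?|? ? []|? ? ? [-> ->]].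
  by move=> u1 u2 v1 v2 h h' [? ?] [? ?]; rewrite !src_cmp !tgt_cmp.
- split=> [u|u v uv|u v w uv vw] R cR PR; have [_ [rR sR tR] _] := cR.
  + exact: rR.
  + by apply: sR; apply: uv.
  + by apply: (tR _ v); [apply: uv|apply: vw].
- move=> u1 u2 v1 v2 h h' u12 v12 R cR PR.
  by apply: (congr1_cmp cR); [apply: u12|apply: v12].
Qed.

Record graph := Graph {
  vert : Type;
  edge : Type;
  esrc : edge -> vert;
  etgt : edge -> vert
}.

Section FreeCategory.
Variable X : graph.

Fixpoint is_walk (x : vert X) (s : seq (edge X)) : Prop :=
  if s is e :: s' then esrc e = x /\ is_walk (etgt e) s' else True.

Fixpoint walk_end (x : vert X) (s : seq (edge X)) : vert X :=
  if s is e :: s' then walk_end (etgt e) s' else x.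

Record gpath := GPath {
  gstart : vert X;
  gedges : seq (edge X);
  gwalk : is_walk gstart gedges
}.

Definition gend (p : gpath) : vert X := walk_end (gstart p) (gedges p).

Lemma gpath_eq (p q : gpath) :
  gstart p = gstart q -> gedges p = gedges q -> p = q.
Proof.
case: p q => [x s w] [y t w'] /= xy st; subst.
by rewrite (Prop_irrelevance w w').
Qed.

Lemma is_walk_cat x s t : is_walk x s -> is_walk (walk_end x s) t ->
  is_walk x (s ++ t).
Proof. by elim: s x => [|e s IHs] x //= [-> ws] wt; split=> //; apply: IHs. Qed.

Lemma walk_end_cat x s t : walk_end x (s ++ t) = walk_end (walk_end x s) t.
Proof. by elim: s x => [|e s IHs] x /=. Qed.

Definition gid (x : vert X) : gpath := @GPath x [::] I.

Definition gcat (p q : gpath) (h : gend p = gstart q) : gpath.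
Proof.
exists (gstart p) (gedges p ++ gedges q).
apply: is_walk_cat; first exact: gwalk.
rewrite -[walk_end _ _]/(gend p) h; exact: gwalk.
Defined.

Definition free_cat : category.
Proof.
refine (@Category (vert X) gpath gstart gend gid gcat _ _ _ _ _ _ _) => //.
- by move=> p q h; rewrite /gend /= walk_end_cat -[walk_end _ (gedges p)]/(gend p) h.
- by move=> p h; apply: gpath_eq.
- by move=> p h; apply: gpath_eq; rewrite //= cats0.
- by move=> p q s ? ? ? ?; apply: gpath_eq; rewrite //= catA.
Defined.

End FreeCategory.

Record polygraph2 := Polygraph2 {
  pgraph : graph;
  gen2 : Type;
  gsrc : gen2 -> mor (free_cat pgraph);
  gtgt : gen2 -> mor (free_cat pgraph);
  gsrc_src : forall a, src (gsrc a) = src (gtgt a);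
  gsrc_tgt : forall a, tgt (gsrc a) = tgt (gtgt a)
}.

Section Polygraph.
Variable S : polygraph2.
Notation S1 := (free_cat (pgraph S)).

Definition gen_rel (u v : mor S1) : Prop :=
  exists a : gen2 S, gsrc a = u /\ gtgt a = v.

Lemma presented_congruence : congruence1 (least_congruence1 gen_rel).
Proof.
apply: least_congruence1P => u v [a [<- <-]].
by rewrite gsrc_src gsrc_tgt.
Qed.

Definition presented : category := quot_cat presented_congruence.

(* Formal composites of the generating 2-cells, with their boundary in the    *)
(* free category.                                                             *)
Inductive term : mor S1 -> mor S1 -> Type :=
| t_gen (a : gen2 S) : term (gsrc a) (gtgt a)
| t_id (u : mor S1) : term u u
| t_inv u v (a : term u v) : term v u
| t_v u v v' w (h : v = v') (a : term u v) (b : term v' w) : term u w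
| t_h u v u' v' (h : tgt u = src u') (h' : tgt v = src v')
    (a : term u v) (b : term u' v') : term (cmp u u' h) (cmp v v' h').

(* The congruence generated by the laws of (2,1)-categories.  It is           *)
(* heterogeneous because, e.g., both sides of associativity of the horizontal *)
(* composition have boundaries that agree only propositionally.               *)
Inductive term_eq : forall u v u' v', term u v -> term u' v' -> Prop :=
| te_refl u v (a : term u v) : term_eq a a
| te_sym u v u' v' (a : term u v) (b : term u' v') :
    term_eq a b -> term_eq b a
| te_trans u v u' v' u'' v''
    (a : term u v) (b : term u' v') (c : term u'' v'') :
    term_eq a b -> term_eq b c -> term_eq a c
| te_inv u v u' v' (a : term u v) (a' : term u' v') :
    term_eq a a' -> term_eq (t_inv a) (t_inv a')
| te_v u v w z (h : v = w) (a : term u v) (b : term w z)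
    u' v' w' z' (h' : v' = w') (a' : term u' v') (b' : term w' z') :
    term_eq a a' -> term_eq b b' -> term_eq (t_v h a b) (t_v h' a' b')
| te_h u v w z h1 h2 (a : term u v) (b : term w z)
    u' v' w' z' h1' h2' (a' : term u' v') (b' : term w' z') :
    term_eq a a' -> term_eq b b' ->
    term_eq (t_h h1 h2 a b) (t_h h1' h2' a' b')
| te_vidl u v w h (a : term u v) : term_eq (@t_v w w u v h (t_id w) a) a
| te_vidr u v w h (a : term u v) : term_eq (@t_v u v w w h a (t_id w)) a
| te_vA u v v' w w' z (a : term u v) (b : term v' w) (c : term w' z)
    (h : v = v') (h' : w = w') :
    term_eq (t_v h' (t_v h a b) c) (t_v h a (t_v h' b c))
| te_vV u v h (a : term u v) : term_eq (t_v h a (t_inv a)) (t_id u)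
| te_Vv u v h (a : term u v) : term_eq (t_v h (t_inv a) a) (t_id v)
| te_hidl x u v h h' (a : term u v) :
    term_eq (@t_h (idm x) (idm x) u v h h' (t_id (idm x)) a) a
| te_hidr x u v h h' (a : term u v) :
    term_eq (@t_h u v (idm x) (idm x) h h' a (t_id (idm x))) a
| te_hA u v u' v' u'' v'' (a : term u v) (b : term u' v') (c : term u'' v'')
    h1 h2 h3 h4 h5 h6 h7 h8 :
    term_eq (@t_h _ _ _ _ h3 h4 (@t_h _ _ _ _ h1 h2 a b) c)
            (@t_h _ _ _ _ h7 h8 a (@t_h _ _ _ _ h5 h6 b c))
| te_hid u v h h' h'' :
    term_eq (@t_h u u v v h h' (t_id u) (t_id v)) (t_id (cmp u v h''))
| te_exch u v v1 w (a : term u v) (b : term v1 w)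
    u' v' v1' w' (a' : term u' v') (b' : term v1' w')
    h1 h2 h3 h4 h5 h6 h7 h8 h9 :
    term_eq (@t_h _ _ _ _ h1 h2 (t_v h3 a b) (t_v h4 a' b'))
            (t_v h9 (@t_h _ _ _ _ h5 h6 a a') (@t_h _ _ _ _ h7 h8 b b')).

Lemma term_par u v (a : term u v) : src u = src v /\ tgt u = tgt v.
Proof.
elim: {u v} a => [a|u|u v _ [-> ->]|u v v' w h _ [-> ->] _ [<- <-]|] //.
- by rewrite gsrc_src gsrc_tgt.
- by rewrite h.
- by move=> u v u' v' h h' _ [? ?] _ [? ?]; rewrite !src_cmp !tgt_cmp.
Qed.

Lemma term_eq_par u v u' v' (a : term u v) (a' : term u' v') :
  term_eq a a' -> u = u' /\ v = v'.
Proof.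
elim=> {u v u' v' a a'}; try by [move=> * | move=> * /=; intuition congruence].
- move=> u v w z h1 h2 a b u' v' w' z' h1' h2' a' b' _ [? ?] _ [? ?]; subst.
  by rewrite (Prop_irrelevance h1 h1') (Prop_irrelevance h2 h2').
- move=> x u v h h' a; have ex : x = src u by rewrite -h tgt_id.
  have ex' : x = src v by rewrite -h' tgt_id.
  split; first by subst x; rewrite cmp_idl.
  by clear ex; subst x; rewrite cmp_idl.
- move=> x u v h h' a; have ex : x = tgt u by rewrite h src_id.
  have ex' : x = tgt v by rewrite h' src_id.
  split; first by subst x; rewrite cmp_idr.
  by clear ex; subst x; rewrite cmp_idr.
- by move=> *; split; apply: cmpA.
- by move=> u v h h' h''; rewrite (Prop_irrelevance h h'') (Prop_irrelevance h' h'').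
- move=> u v v1 w a b u' v' v1' w' a' b' h1 h2 h3 h4 h5 h6 h7 h8 h9.
  by rewrite (Prop_irrelevance h1 h5) (Prop_irrelevance h2 h8).
Qed.

Record pterm := PTerm { pts : mor S1; ptt : mor S1; ptm : term pts ptt }.

Definition pterm_eq (a b : pterm) : Prop := term_eq (ptm a) (ptm b).

Lemma pterm_equiv : Equivalence pterm_eq.
Proof.
split=> [a|a b|a b c]; rewrite /pterm_eq.
- exact: te_refl.
- exact: te_sym.
- exact: te_trans.
Qed.

Notation K := (@cls pterm pterm_eq pterm_equiv).

Definition free_cell : Type := quot pterm_equiv.
Definition fc_src (f : free_cell) : mor S1 := pts (rep f).
Definition fc_tgt (f : free_cell) : mor S1 := ptt (rep f).
Definition fc_id (u : mor S1) : free_cell := K (PTerm (t_id u)).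

Definition fc_v (f g : free_cell) (h : fc_tgt f = fc_src g) : free_cell :=
  K (PTerm (t_v h (ptm (rep f)) (ptm (rep g)))).

Lemma fc_h_comp (f g : free_cell) :
  tgt (fc_src f) = src (fc_src g) -> tgt (fc_tgt f) = src (fc_tgt g).
Proof.
by move=> h; rewrite -(term_par (ptm (rep f))).2 -(term_par (ptm (rep g))).1.
Qed.

Definition fc_h (f g : free_cell) (h : tgt (fc_src f) = src (fc_src g)) :
  free_cell :=
  K (PTerm (t_h h (fc_h_comp h) (ptm (rep f)) (ptm (rep g)))).

Let Ksrc a : fc_src (K a) = pts a.
Proof. by case: (term_eq_par (rep_cls pterm_equiv a)). Qed.

Let Ktgt a : fc_tgt (K a) = ptt a.
Proof. by case: (term_eq_par (rep_cls pterm_equiv a)). Qed.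

Let Kv a b h h' : @fc_v (K a) (K b) h = K (PTerm (t_v h' (ptm a) (ptm b))).
Proof. by apply/clsP; apply: te_v; apply: (rep_cls pterm_equiv). Qed.

Let Kh a b h h' h'' :
  @fc_h (K a) (K b) h = K (PTerm (@t_h _ _ _ _ h' h'' (ptm a) (ptm b))).
Proof. by apply/clsP; apply: te_h; apply: (rep_cls pterm_equiv). Qed.

Let KP (P : free_cell -> Prop) : (forall a, P (K a)) -> forall f, P f.
Proof. by move=> PK f; rewrite -(repK f). Qed.

Definition free21 : two_category.
Proof.
refine (@TwoCategory S1 free_cell fc_src fc_tgt _ _ fc_id fc_v fc_h
  _ _ _ _ _ _ _ _ _ _ _ _ _ _).
- by move=> f; case: (term_par (ptm (rep f))).
- by move=> f; case: (term_par (ptm (rep f))).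
- by move=> u; rewrite Ksrc.
- by move=> u; rewrite Ktgt.
- by move=> f g h; rewrite Ksrc.
- by move=> f g h; rewrite Ktgt.
- by move=> f g h h'; rewrite Ksrc /= (Prop_irrelevance h h').
- by move=> f g h h'; rewrite Ktgt /= (Prop_irrelevance (fc_h_comp h) h').
- elim/KP=> a h; rewrite (@Kv (PTerm (t_id _)) a h (Ksrc a)).
  by apply/clsP; apply: te_vidl.
- elim/KP=> a h; rewrite (@Kv a (PTerm (t_id _)) h (esym (Ktgt a))).
  by apply/clsP; apply: te_vidr.
- elim/KP=> a; elim/KP=> b; elim/KP=> c h1 h2 h3 h4.
  have e1 : ptt a = pts b by rewrite -Ktgt -Ksrc.
  have e2 : ptt b = pts c by rewrite -Ktgt -Ksrc.
  have k1 := Kv h1 e1; have k3 := Kv h3 e2.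
  move: h2 h4; rewrite k1 k3 => h2 h4.
  rewrite (@Kv (PTerm (t_v e1 (ptm a) (ptm b))) c h2 e2).
  rewrite (@Kv a (PTerm (t_v e2 (ptm b) (ptm c))) h4 e1).
  by apply/clsP; apply: te_vA.
- elim/KP=> a h.
  have [e1 e2] := term_par (ptm a).
  have h1 : tgt (idm (src (fc_src (K a)))) = src (pts a) by rewrite tgt_id Ksrc.
  have h2 : tgt (idm (src (fc_src (K a)))) = src (ptt a) by rewrite tgt_id Ksrc.
  by rewrite (@Kh (PTerm (t_id _)) a h h1 h2); apply/clsP; apply: te_hidl.
- elim/KP=> a h.
  have [e1 e2] := term_par (ptm a).
  have h1 : tgt (pts a) = src (idm (tgt (fc_src (K a)))) by rewrite src_id Ksrc.
  have h2 : tgt (ptt a) = src (idm (tgt (fc_src (K a)))) by rewrite src_id Ksrc.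
  by rewrite (@Kh a (PTerm (t_id _)) h h1 h2); apply/clsP; apply: te_hidr.
- elim/KP=> a; elim/KP=> b; elim/KP=> c h1 h2 h3 h4.
  have e1 : tgt (pts a) = src (pts b) by rewrite -!Ksrc.
  have e2 : tgt (pts b) = src (pts c) by rewrite -!Ksrc.
  have d1 : tgt (ptt a) = src (ptt b).
    by rewrite -(term_par (ptm a)).2 -(term_par (ptm b)).1.
  have d2 : tgt (ptt b) = src (ptt c).
    by rewrite -(term_par (ptm b)).2 -(term_par (ptm c)).1.
  have k1 := Kh h1 e1 d1; have k3 := Kh h3 e2 d2.
  move: h2 h4; rewrite k1 k3 => h2 h4.
  have e3 : tgt (cmp (pts a) (pts b) e1) = src (pts c) by rewrite tgt_cmp.
  have d3 : tgt (cmp (ptt a) (ptt b) d1) = src (ptt c) by rewrite tgt_cmp.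
  have e4 : tgt (pts a) = src (cmp (pts b) (pts c) e2) by rewrite src_cmp.
  have d4 : tgt (ptt a) = src (cmp (ptt b) (ptt c) d2) by rewrite src_cmp.
  rewrite (@Kh (PTerm (t_h e1 d1 (ptm a) (ptm b))) c h2 e3 d3).
  rewrite (@Kh a (PTerm (t_h e2 d2 (ptm b) (ptm c))) h4 e4 d4).
  by apply/clsP; apply: te_hA.
- move=> u v h h'.
  by rewrite (@Kh (PTerm (t_id u)) (PTerm (t_id v)) h h' h'); apply/clsP; apply: te_hid.
- elim/KP=> a; elim/KP=> b; elim/KP=> a'; elim/KP=> b' h1 h2 h3 h4 h5 h6.
  have e1 : ptt a = pts b by rewrite -Ktgt -Ksrc.
  have e2 : ptt a' = pts b' by rewrite -Ktgt -Ksrc.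
  have s1 : tgt (pts a) = src (pts a') by rewrite -!Ksrc.
  have s2 : tgt (ptt a) = src (ptt a').
    by rewrite -(term_par (ptm a)).2 -(term_par (ptm a')).1.
  have s3 : tgt (pts b) = src (pts b') by rewrite -e1 -e2.
  have s4 : tgt (ptt b) = src (ptt b').
    by rewrite -(term_par (ptm b)).2 -(term_par (ptm b')).1.
  have k1 := Kv h1 e1; have k2 := Kv h2 e2.
  have k4 := Kh h4 s1 s2; have k5 := Kh h5 s3 s4.
  move: h3 h6; rewrite k1 k2 k4 k5 => h3 h6.
  have h6' : cmp (ptt a) (ptt a') s2 = cmp (pts b) (pts b') s3.
    by move: h6; rewrite Ktgt Ksrc.
  rewrite (@Kh (PTerm (t_v e1 (ptm a) (ptm b)))
             (PTerm (t_v e2 (ptm a') (ptm b'))) h3 s1 s4).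
  rewrite (@Kv (PTerm (t_h s1 s2 (ptm a) (ptm a')))
             (PTerm (t_h s3 s4 (ptm b) (ptm b'))) h6 h6').
  by apply/clsP; apply: te_exch.
Defined.

Definition gen_cell (a : gen2 S) : cell free21 := K (PTerm (t_gen a)).

Lemma csrc_gen a : csrc (gen_cell a) = gsrc a.
Proof. exact: Ksrc. Qed.

Lemma ctgt_gen a : ctgt (gen_cell a) = gtgt a.
Proof. exact: Ktgt. Qed.

Let Kinv u v (a : term u v) :
  exists (h : ctgt (K (PTerm a) : cell free21) = csrc (K (PTerm (t_inv a)) : cell free21))
         (h' : ctgt (K (PTerm (t_inv a)) : cell free21) = csrc (K (PTerm a) : cell free21)),
    vcmp _ _ h = id2 (csrc (K (PTerm a) : cell free21)) /\
    vcmp _ _ h' = id2 (ctgt (K (PTerm a) : cell free21)).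
Proof.
have h : fc_tgt (K (PTerm a)) = fc_src (K (PTerm (t_inv a))) by rewrite Ktgt Ksrc.
have h' : fc_tgt (K (PTerm (t_inv a))) = fc_src (K (PTerm a)) by rewrite Ktgt Ksrc.
exists h, h'; split; rewrite /= ?Ksrc ?Ktgt.
- rewrite (@Kv (PTerm a) (PTerm (t_inv a)) h erefl).
  by apply/clsP; apply: te_vV.
- rewrite (@Kv (PTerm (t_inv a)) (PTerm a) h' erefl).
  by apply/clsP; apply: te_Vv.
Qed.

Lemma free21_invertible (f : cell free21) : invertible f.
Proof.
elim/KP: f => -[u v a]; exists (K (PTerm (t_inv a))).
exact: Kinv.
Qed.

Lemma free21_ind (P : cell free21 -> Prop) :
  (forall a, P (gen_cell a)) ->
  (forall u, P (id2 u)) ->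
  (forall f g h h', P f -> vcmp f g h = id2 (csrc f) ->
     vcmp g f h' = id2 (ctgt f) -> P g) ->
  (forall f g h, P f -> P g -> P (vcmp f g h)) ->
  (forall f g h, P f -> P g -> P (hcmp f g h)) ->
  forall f, P f.
Proof.
move=> Pg Pi PV Pv Ph; elim/KP=> -[u v a].
elim: a => {u v} [a|u|u v a IHa|u v v' w h a IHa b IHb|].
- exact: Pg.
- exact: Pi.
- by have [h [h' [e e']]] := Kinv a; apply: (PV _ _ h h' IHa).
- have h' : fc_tgt (K (PTerm a)) = fc_src (K (PTerm b)) by rewrite Ktgt Ksrc.
  by move: (Pv _ _ h' IHa IHb); rewrite /= (@Kv (PTerm a) (PTerm b) h' h).
- move=> u v u' v' h h' a IHa b IHb.
  have k : tgt (fc_src (K (PTerm a))) = src (fc_src (K (PTerm b))).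
    by rewrite !Ksrc.
  by move: (Ph _ _ k IHa IHb); rewrite /= (@Kh (PTerm a) (PTerm b) k h h').
Qed.

Definition presentation (C : category) : Type := cat_iso presented C.

Lemma term_presented u v (a : term u v) : least_congruence1 gen_rel u v.
Proof.
have cR := presented_congruence; have eR := congr1_equiv cR.
elim: {u v} a => [a|u|u v _ IH|u v v' w h _ IH _ IH'|u v u' v' h h' _ IH _ IH'].
- by move=> R _; apply; exists a.
- exact: (@Equivalence_Reflexive _ _ eR).
- exact: (@Equivalence_Symmetric _ _ eR).
- by rewrite -h in IH'; apply: (@Equivalence_Transitive _ _ eR) IH IH'.
- exact: (congr1_cmp cR).
Qed.

Definition projection (C : category) (p : presentation C) :
  two_functor free21 (locally_discrete C).
Proof.
pose Q := functor_comp (iso_fun p) (quot_functor presented_congruence).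
have Qst (f : cell free21) : fmor Q (csrc f) = fmor Q (ctgt f).
  congr (fmor (iso_fun p)).
  by apply/clsP; apply: term_presented (ptm (rep f)).
refine (@TwoFunctor free21 (locally_discrete C) Q
  (fun f => id2 (fmor Q (csrc f) : mor (locally_discrete C))) _ _ _ _ _).
- by [].
- exact: Qst.
- by move=> u; rewrite csrc_id.
- by move=> f g h h'; rewrite csrc_v.
- move=> f g h h'; rewrite (csrc_h h h).
  exact: (@fcmp _ _ Q (csrc f) (csrc g) h h').
Defined.

End Polygraph.

Record cellular_extension (A : two_category) := CellularExtension {
  cell3 : Type;
  src3 : cell3 -> cell A;
  tgt3 : cell3 -> cell A;
  par3 : forall c, parallel (src3 c) (tgt3 c)
}.

Record congruence2 (A : two_category) (R : cell A -> cell A -> Prop) : Prop := {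
  congr2_par : forall f g, R f g -> parallel f g;
  congr2_equiv : Equivalence R;
  congr2_v : forall f f' g g' h h',
    R f f' -> R g g' -> R (vcmp f g h) (vcmp f' g' h');
  congr2_h : forall f f' g g' h h',
    R f f' -> R g g' -> R (hcmp f g h) (hcmp f' g' h')
}.

Definition equiv_mod (A : two_category) (Gamma : cellular_extension A)
  (f g : cell A) : Prop :=
  forall R, congruence2 R ->
    (forall c : cell3 Gamma, R (src3 c) (tgt3 c)) -> R f g.

Definition homotopy_basis (A : two_category) (Gamma : cellular_extension A) :
  Prop :=
  forall f g : cell A, parallel f g -> equiv_mod Gamma f g.

Definition ext_sum (A : two_category) (Gamma Delta : cellular_extension A) :
  cellular_extension A.
Proof.
exists (cell3 Gamma + cell3 Delta)%type
  (fun c => match c with inl c => src3 c | inr c => src3 c end)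
  (fun c => match c with inl c => tgt3 c | inr c => tgt3 c end).
by case=> c; apply: par3.
Defined.

Definition ext_image (A B : two_category) (F : two_functor A B)
  (Gamma : cellular_extension A) : cellular_extension B.
Proof.
exists (cell3 Gamma) (fun c => fcell F (src3 c)) (fun c => fcell F (tgt3 c)).
by move=> c; have [e e'] := par3 c; rewrite /parallel !fcsrc !fctgt e e'.
Defined.

(* A functorial family of 2-cells H u => u; H is not required to be the       *)
(* identity on 0-cells, but this follows from fam_src and fam_tgt.            *)
Record functorial_family (A : two_category) (H : two_functor A A) := Family {
  fam :> mor A -> cell A;
  fam_src : forall u, csrc (fam u) = fmor H u;
  fam_tgt : forall u, ctgt (fam u) = u;
  fam_id : forall x, fam (idm x) = id2 (idm x);
  fam_cmp : forall u u' h h', fam (cmp u u' h) = hcmp (fam u) (fam u') h'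
}.

Section Naturality.
Variables (S : polygraph2) (H : two_functor (free21 S) (free21 S)).
Variable tau : functorial_family H.

Lemma nat_src_comp (a : gen2 S) :
  ctgt (fcell H (gen_cell a)) = csrc (tau (gtgt a)).
Proof. by rewrite fctgt fam_src ctgt_gen. Qed.

Lemma nat_tgt_comp (a : gen2 S) :
  ctgt (tau (gsrc a)) = csrc (gen_cell a).
Proof. by rewrite fam_tgt csrc_gen. Qed.

(* One 3-cell  H(a) *1 tau_v ==> tau_u *1 a  for each generator a : u => v.   *)
Definition ext_naturality : cellular_extension (free21 S).
Proof.
exists (gen2 S)
  (fun a => vcmp (fcell H (gen_cell a)) (tau (gtgt a)) (nat_src_comp a))
  (fun a => vcmp (tau (gsrc a)) (gen_cell a) (nat_tgt_comp a)).
move=> a; split; first by rewrite !csrc_v fcsrc fam_src csrc_gen.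
by rewrite !ctgt_v fam_tgt ctgt_gen.
Defined.

End Naturality.

(* Main.v *)
Require Import Defs.
From mathcomp Require Import all_boot boolp.
From Stdlib Require Import RelationClasses.

Set Implicit Arguments.
Unset Strict Implicit.
Unset Printing Implicit Defensive.

(* Parallel cells f, g : u => v of Xi^T have parallel images under G, which   *)
(* are identified by Gamma; hence FG(f) and FG(g) are identified by F(Gamma). *)
(* The 3-cells tau_alpha make tau natural on generators modulo the            *)
(* congruence, and naturality propagates to all composites because tau is     *)
(* functorial.  As tau_u is invertible, f is congruent to                     *)
(* tau_u^-1 *1 FG(f) *1 tau_v, which only depends on FG(f) and on u, v.       *)

(** Fix a congruence [R] containing the 3-cells of Delta and put H = FG. Since Gamma relates G(f)
    and G(g), [equiv_mod_image] makes H(f) and H(g) [R]-related. The squares tau_alpha extend to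
    every 2-cell by induction ([natural_mod_ext_naturality]), and cancelling the invertible tau_u
    brings the relation down to f and g ([natural_mod_inj]). Composites carry proofs of
    composability, so [vcmp_eq] replaces cells and proofs together. *)

Lemma vcmp_eq (A : two_category) (f f' g g' : cell A) h h' :
  f = f' -> g = g' -> vcmp f g h = vcmp f' g' h'.
Proof. by move=> ff' gg'; subst; rewrite (Prop_irrelevance h h'). Qed.

Lemma congruence2_parallel (A : two_category) : congruence2 (@parallel A).
Proof.
split=> //.
- by split=> [f|f g []|f g k [fg fg'] [gk gk']]; rewrite /parallel ?fg ?fg'.
- by move=> f f' g g' h h' [ff' _] [_ gg']; split; rewrite !(csrc_v, ctgt_v).
- move=> f f' g g' h h' [sff' tff'] [sgg' tgg'].
  have k : tgt (ctgt f) = src (ctgt g) by rewrite -csrc_tgt -csrc_src.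
  have k' : tgt (ctgt f') = src (ctgt g') by rewrite -csrc_tgt -csrc_src.
  split; [rewrite (csrc_h h h) (csrc_h h' h')
        |rewrite (ctgt_h h k) (ctgt_h h' k')].
    by move: h h'; rewrite sff' sgg' => h h'; rewrite (Prop_irrelevance h h').
  by move: k k'; rewrite tff' tgg' => k k'; rewrite (Prop_irrelevance k k').
Qed.

Section Preimage.
Variables (A B : two_category) (F : two_functor A B).

(** Parallelism is imposed separately because [F] need not reflect it. *)
Lemma congruence2_preimage (R : cell B -> cell B -> Prop) :
  congruence2 R ->
  congruence2 (fun f g => parallel f g /\ R (fcell F f) (fcell F g)).
Proof.
move=> [_ [rR sR tR] Rv Rh].
have [_ [rP sP tP] Pv Ph] := congruence2_parallel A.
split; first by move=> f g [].
- split=> [f|f g [fg Rfg]|f g k [fg Rfg] [gk Rgk]].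
  + by split; [apply: rP|apply: rR].
  + by split; [apply: sP|apply: sR].
  + by split; [apply: tP gk|apply: tR Rgk].
- move=> f f' g g' h h' [ff' Rff'] [gg' Rgg'].
  have k : ctgt (fcell F f) = csrc (fcell F g) by rewrite fctgt fcsrc h.
  have k' : ctgt (fcell F f') = csrc (fcell F g') by rewrite fctgt fcsrc h'.
  by split; [apply: Pv|rewrite (fvcmp h k) (fvcmp h' k'); apply: Rv].
- move=> f f' g g' h h' [ff' Rff'] [gg' Rgg'].
  have k : tgt (csrc (fcell F f)) = src (csrc (fcell F g)).
    by rewrite !fcsrc ftgt fsrc h.
  have k' : tgt (csrc (fcell F f')) = src (csrc (fcell F g')).
    by rewrite !fcsrc ftgt fsrc h'.
  by split; [apply: Ph|rewrite (fhcmp h k) (fhcmp h' k'); apply: Rh].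
Qed.

(** A congruence containing F(Gamma) pulls back along [F] to one containing Gamma. *)
Lemma equiv_mod_image (Gamma : cellular_extension A) (f g : cell A) :
  equiv_mod Gamma f g -> equiv_mod (ext_image F Gamma) (fcell F f) (fcell F g).
Proof.
move=> fg R cR GR; have [] // := fg _ (congruence2_preimage cR).
by move=> c; split; [apply: par3|apply: GR].
Qed.

End Preimage.

Section NaturalModulo.
Variables (A : two_category) (H : two_functor A A) (tau : functorial_family H).
Variables (R : cell A -> cell A -> Prop) (cR : congruence2 R).

Let rR f : R f f.
Proof. exact: (@Equivalence_Reflexive _ _ (congr2_equiv cR)). Qed.

Let tR f g k : R f g -> R g k -> R f k.
Proof. exact: (@Equivalence_Transitive _ _ (congr2_equiv cR)). Qed.

Let sR f g : R f g -> R g f.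
Proof. exact: (@Equivalence_Symmetric _ _ (congr2_equiv cR)). Qed.

Let Rv f f' g g' h h' : R f f' -> R g g' -> R (vcmp f g h) (vcmp f' g' h').
Proof. exact: congr2_v. Qed.

(** The naturality square of [tau] at [f], up to [R]. It is never vacuous: [ctgt_image] and
    [ctgt_fam] provide the composability proofs. *)
Definition natural_mod (f : cell A) : Prop :=
  forall h h',
    R (vcmp (fcell H f) (tau (ctgt f)) h) (vcmp (tau (csrc f)) f h').

Lemma ctgt_image f : ctgt (fcell H f) = csrc (tau (ctgt f)).
Proof. by rewrite fctgt fam_src. Qed.

Lemma ctgt_fam f : ctgt (tau (csrc f)) = csrc f.
Proof. by rewrite fam_tgt. Qed.

Lemma natural_mod_id2 u : natural_mod (id2 u).
Proof.
move=> h h'.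
have k : ctgt (id2 (csrc (tau u))) = csrc (tau u) by rewrite ctgt_id.
have k' : ctgt (tau u) = csrc (id2 (ctgt (tau u))) by rewrite csrc_id.
have -> : vcmp _ _ h = tau u.
  rewrite -[RHS](vcmp_idl k); apply: vcmp_eq; last by rewrite ctgt_id.
  by rewrite fid2 fam_src.
have -> // : vcmp _ _ h' = tau u.
rewrite -[RHS](vcmp_idr k'); apply: vcmp_eq; first by rewrite csrc_id.
by rewrite fam_tgt.
Qed.

(** Pasting of squares: H f *1 H g *1 tau is related to H f *1 tau *1 g, then to tau *1 f *1 g. *)
Lemma natural_mod_vcmp f g h :
  natural_mod f -> natural_mod g -> natural_mod (vcmp f g h).
Proof.
move=> nf ng.
have hF : ctgt (fcell H f) = csrc (fcell H g) by rewrite fctgt fcsrc h.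
have f1 := ctgt_image f; have f2 := ctgt_fam f.
have g1 := ctgt_image g; have g2 := ctgt_fam g.
have m : ctgt (fcell H f) = csrc (tau (csrc g)) by rewrite f1 h.
have m' : ctgt (vcmp (fcell H f) (tau (csrc g)) m) = csrc g by rewrite ctgt_v.
have m'' : ctgt (fcell H f) = csrc (vcmp (tau (csrc g)) g g2) by rewrite csrc_v.
have l : ctgt (vcmp (tau (csrc f)) f f2) = csrc g by rewrite ctgt_v.
have r : ctgt (tau (csrc f)) = csrc (vcmp f g h) by rewrite csrc_v.
have a : ctgt (fcell H f) = csrc (vcmp (fcell H g) (tau (ctgt g)) g1).
  by rewrite csrc_v.
have a' : ctgt (vcmp (fcell H f) (fcell H g) hF) = csrc (tau (ctgt g)).
  by rewrite ctgt_v.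
have key : R (vcmp (vcmp (fcell H f) (fcell H g) hF) (tau (ctgt g)) a')
             (vcmp (tau (csrc f)) (vcmp f g h) r).
  rewrite (vcmpA a' a) -(vcmpA l r).
  apply: (tR (g := vcmp _ _ m'')); first by apply: Rv.
  rewrite -(vcmpA m' m''); apply: Rv => //.
  have -> : vcmp _ _ m = vcmp (fcell H f) (tau (ctgt f)) f1.
    by apply: vcmp_eq; rewrite ?h.
  exact: nf.
move=> k k'; have -> : vcmp _ _ k = vcmp _ _ a'.
  by apply: vcmp_eq; rewrite ?ctgt_v // (fvcmp h hF).
have -> // : vcmp _ _ k' = vcmp _ _ r.
by apply: vcmp_eq; rewrite ?csrc_v.
Qed.

(** Functoriality splits [tau] at a composite 1-cell; by exchange, the required square is then the
    horizontal composite of the squares of [f] and [g]. *)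
Lemma natural_mod_hcmp f g h :
  natural_mod f -> natural_mod g -> natural_mod (hcmp f g h).
Proof.
move=> nf ng.
(* As [tau u] is a 2-cell, H u and u share their endpoints, which makes the cells of [tau]
   horizontally composable. *)
have st u : src (csrc (tau u)) = src u by rewrite csrc_src fam_tgt.
have tt u : tgt (csrc (tau u)) = tgt u by rewrite csrc_tgt fam_tgt.
have h' : tgt (ctgt f) = src (ctgt g) by rewrite -csrc_tgt -csrc_src.
have f1 := ctgt_image f; have f2 := ctgt_fam f.
have g1 := ctgt_image g; have g2 := ctgt_fam g.
have hF : tgt (csrc (fcell H f)) = src (csrc (fcell H g)).
  by rewrite !fcsrc ftgt fsrc h.
have ht : tgt (csrc (tau (ctgt f))) = src (csrc (tau (ctgt g))).
  by rewrite st tt.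
have hs : tgt (csrc (tau (csrc f))) = src (csrc (tau (csrc g))).
  by rewrite st tt.
have m : tgt (csrc (vcmp (fcell H f) (tau (ctgt f)) f1)) =
         src (csrc (vcmp (fcell H g) (tau (ctgt g)) g1)) by rewrite !csrc_v.
have m' : tgt (csrc (vcmp (tau (csrc f)) f f2)) =
          src (csrc (vcmp (tau (csrc g)) g g2)) by rewrite !csrc_v.
have Rm : R (hcmp _ _ m) (hcmp _ _ m').
  by apply: (congr2_h cR); [apply: nf|apply: ng].
move=> k k'.
have eF : fcell H (hcmp f g h) = hcmp _ _ hF := fhcmp h hF.
have et : tau (ctgt (hcmp f g h)) = hcmp _ _ ht.
  by rewrite (ctgt_h h h') (fam_cmp h' ht).
have es : tau (csrc (hcmp f g h)) = hcmp _ _ hs.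
  by rewrite (csrc_h h h) (fam_cmp h hs).
have a : ctgt (hcmp _ _ hF) = csrc (hcmp _ _ ht) by rewrite -eF -et.
have a' : ctgt (hcmp _ _ hs) = csrc (hcmp f g h) by rewrite -es.
rewrite (vcmp_eq k a eF et) (vcmp_eq k' a' es erefl).
by rewrite -(exchange m a) -(exchange m' a').
Qed.

Lemma natural_mod_inv f g h h' :
  natural_mod f -> vcmp f g h = id2 (csrc f) -> vcmp g f h' = id2 (ctgt f) ->
  natural_mod g.
Proof.
move=> nf fg gf k k'.
have f1 := ctgt_image f; have f2 := ctgt_fam f.
have e : csrc g = ctgt f by rewrite h.
have hF : ctgt (fcell H g) = csrc (fcell H f) by rewrite fctgt fcsrc h'.
(* For f : u => v, both sides arise by composing the naturality square of f   *)
(* with H g on the left and g on the right, and cancelling: the left side is  *)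
(* H g *1 (tau_u *1 f) *1 g and the right side H g *1 (H f *1 tau_v) *1 g.    *)
have a : ctgt (fcell H g) = csrc (vcmp (fcell H f) (tau (ctgt f)) f1).
  by rewrite csrc_v.
have b : ctgt (fcell H g) = csrc (vcmp (tau (csrc f)) f f2).
  by rewrite csrc_v fctgt fam_src h'.
have a1 : ctgt (vcmp _ _ a) = csrc g by rewrite !ctgt_v fam_tgt.
have b1 : ctgt (vcmp _ _ b) = csrc g by rewrite !ctgt_v.
have Rab : R (vcmp _ _ a1) (vcmp _ _ b1).
  by apply: Rv => //; apply: Rv => //; apply: nf.
have -> : vcmp _ _ k = vcmp _ _ b1.
  have c : ctgt (vcmp (tau (csrc f)) f f2) = csrc g by rewrite ctgt_v.
  have c1 : ctgt (fcell H g) = csrc (vcmp _ _ c).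
    by rewrite !csrc_v fctgt fam_src h'.
  have c2 : ctgt (tau (csrc f)) = csrc (vcmp f g h) by rewrite csrc_v.
  rewrite (vcmpA b1 c1); apply: vcmp_eq => //.
  rewrite (vcmpA c c2).
  have d : ctgt (tau (csrc f)) = csrc (id2 (ctgt (tau (csrc f)))).
    by rewrite csrc_id.
  rewrite h' -[LHS](vcmp_idr d); apply: vcmp_eq => //.
  by rewrite fam_tgt fg.
have -> : vcmp _ _ k' = vcmp _ _ a1; last exact: sR.
have c : ctgt (vcmp _ _ hF) = csrc (tau (ctgt f)) by rewrite ctgt_v.
apply: vcmp_eq => //; rewrite -(vcmpA c a) e.
have d : ctgt (id2 (csrc (tau (ctgt f)))) = csrc (tau (ctgt f)).
  by rewrite ctgt_id.
rewrite -[LHS](vcmp_idl d); apply: vcmp_eq => //.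
by rewrite -(fvcmp h') gf fid2 fam_src.
Qed.

(** Naturality relates [f] to tau_u^-1 *1 H f *1 tau_v, which depends only on H f and the boundary
    of [f]. *)
Lemma natural_mod_inj f g :
  natural_mod f -> natural_mod g -> invertible (tau (csrc f)) ->
  parallel f g -> R (fcell H f) (fcell H g) -> R f g.
Proof.
move=> nf ng [i [h [h' [_ it]]]] [sfg tfg] RH.
have cancel k : csrc k = csrc f ->
    forall l l', k = vcmp i (vcmp (tau (csrc f)) k l) l'.
  move=> sk l l'; have m : ctgt (vcmp i (tau (csrc f)) h') = csrc k.
    by rewrite ctgt_v.
  rewrite -(vcmpA m l').
  have d : ctgt (id2 (csrc k)) = csrc k by rewrite ctgt_id.
  rewrite -[LHS](vcmp_idl d); apply: vcmp_eq => //.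
  by rewrite it fam_tgt sk.
have f1 := ctgt_image f; have f2 := ctgt_fam f.
have g1 := ctgt_image g; have g2 := ctgt_fam g.
have g2' : ctgt (tau (csrc f)) = csrc g by rewrite sfg.
have l : ctgt i = csrc (vcmp _ _ f2) by rewrite csrc_v.
have l' : ctgt i = csrc (vcmp _ _ g2') by rewrite csrc_v.
rewrite (cancel f erefl f2 l) (cancel g (esym sfg) g2' l').
(* With the inverse [i] stripped off, the chain is tau_u *1 f, H f *1 tau_v, H g *1 tau_v, tau_u *1
   g. *)
apply: Rv => //; apply: tR (sR (nf f1 f2)) _.
rewrite (@vcmp_eq _ _ (tau (csrc g)) g g g2' g2) ?sfg //.
by apply: tR (ng g1 g2); apply: Rv => //; rewrite tfg.
Qed.

End NaturalModulo.

(** On generators the square is a 3-cell of the extension; the closure lemmas handle the other cases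
    of [free21_ind]. *)
Lemma natural_mod_ext_naturality (S : polygraph2)
  (H : two_functor (free21 S) (free21 S)) (tau : functorial_family H)
  (R : cell (free21 S) -> cell (free21 S) -> Prop) :
  congruence2 R ->
  (forall c : cell3 (ext_naturality tau), R (src3 c) (tgt3 c)) ->
  forall f, natural_mod tau R f.
Proof.
move=> cR natR; apply: free21_ind.
- move=> a h h'; rewrite (vcmp_eq h (nat_src_comp tau a) erefl) ?ctgt_gen //.
  rewrite (vcmp_eq h' (nat_tgt_comp tau a)) ?csrc_gen //; exact: natR.
- exact: natural_mod_id2.
- by move=> f g h h'; apply: natural_mod_inv.
- exact: natural_mod_vcmp.
- exact: natural_mod_hcmp.
Qed.

Theorem theorem4p2p2 (C : category) (Sigma Xi : polygraph2)
  (pSigma : presentation Sigma C) (pXi : presentation Xi C)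
  (F : two_functor (free21 Sigma) (free21 Xi))
  (G : two_functor (free21 Xi) (free21 Sigma))
  (hF : two_functor_comp (projection pXi) F = projection pSigma)
  (hG : two_functor_comp (projection pSigma) G = projection pXi)
  (sigma : functorial_family (two_functor_comp G F))
  (tau : functorial_family (two_functor_comp F G))
  (Gamma : cellular_extension (free21 Sigma))
  (hGamma : homotopy_basis Gamma) :
  homotopy_basis (ext_sum (ext_image F Gamma) (ext_naturality tau)).
Proof.
move=> f g fg R cR dR.
have nat := natural_mod_ext_naturality cR (fun c => dR (inr c)).
apply: (natural_mod_inj cR (nat f) (nat g) _ fg).
  exact: free21_invertible.
have pG : parallel (fcell G f) (fcell G g).
  by have [e e'] := fg; rewrite /parallel !fcsrc !fctgt e e'.
apply: (equiv_mod_image (hGamma _ _ pG) cR) => c; exact: (dR (inl c)).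
Qed.
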